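(* Let $F_{3,2}$ be the $3$-graph on vertex set $\{1,2,3,4,5\}$ with edge set $\{123,145,245,345\}$, and let $C_5^{3-}$ be the $3$-graph obtained from the tight $5$-cycle $C_5^3$ by removing one edge. Then $$\pi(F_{3,2}, C_5^{3-}) = \frac{2}{9} < \min\{\pi(F_{3,2}),\pi(C_5^{3-})\}.$$
   Context: A $3$-graph is a finite $3$-uniform hypergraph: a finite vertex set together with a set of $3$-element subsets (edges); $xyz$ abbreviates $\{x,y,z\}$. The tight $\ell$-cycle $C_\ell^3$ is the $3$-graph on $\{1,\dots,\ell\}$ whose edges are all $\ell$ consecutive triples in the cyclic order; thus $C_5^3$ has edges $123,234,345,451,512$. For a family $\mathcal{F}$ of $3$-graphs, a $3$-graph is $\mathcal{F}$-free if it contains no member of $\mathcal{F}$ as a (not necessarily induced) subhypergraph; $\operatorname{ex}(n,\mathcal{F})$ is the maximum number of edges in an $n$-vertex $\mathcal{F}$-free $3$-graph, and $\pi(\mathcal{F}) := \lim_{n\to\infty} \operatorname{ex}(n,\mathcal{F})/\binom{n}{3}$ is the Turán density. Braces are omitted: $\pi(F)=\pi(\{F\})$ and $\pi(F,G)=\pi(\{F,G\})$. *)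

(* Defs.v *)
From mathcomp Require Import all_boot all_order all_algebra.
From mathcomp Require Import all_classical all_reals all_analysis.
From mathcomp Require Import zify.
Set Implicit Arguments.
Unset Strict Implicit.
Unset Printing Implicit Defensive.
Import Order.TTheory GRing.Theory Num.Theory.
Import numFieldNormedType.Exports.

Record graph3 := Graph3 {
  vertex : finType;
  edges : {set {set vertex}};
  edges_card3 : forall e, e \in edges -> #|e| = 3 }.

(* MathComp-Analysis' [set graph3] is not available here: graph3 contains a
   finType, so it lives in a universe above the one of [set]. *)
Definition family := graph3 -> Prop.

Definition family1 (F : graph3) : family := fun H => H = F.

Definition family2 (F G : graph3) : family := fun H => H = F \/ H = G.

Definition contains (H F : graph3) : Prop :=
  exists f : vertex F -> vertex H,
    injective f /\ forall e, e \in edges F -> f @: e \in edges H.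

Definition family_free (FF : family) (H : graph3) : Prop :=
  forall F, FF F -> ~ contains H F.

(* A 3-graph on n vertices has at most 'C(n, 3) edges, so bounding k by
   'C(n, 3) excludes nothing. *)
Definition turan_number (n : nat) (FF : family) : nat :=
  \max_(k < 'C(n, 3).+1 |
    `[< exists H : graph3,
          [/\ #|vertex H| = n, #|edges H| = k & family_free FF H] >]) k.

(* [limn] is total, with value 0 on a divergent sequence, so a nonzero value of
   [turan_density] entails that the limit exists. For n < 3 the quotient is the
   conventional 0. *)
Definition turan_density (R : realType) (FF : family) : R :=
  limn (fun n : nat => (turan_number n FF)%:R / 'C(n, 3)%:R : R)%R.

Lemma cards3 (T : finType) (a b c : T) :
  uniq [:: a; b; c] -> #|[set a; b; c]| = 3.
Proof.
rewrite /= !inE negb_or => /andP[/andP[ab ac] /andP[bc _]].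
by rewrite finset.setUC cardsU1 !inE negb_or cards2 ab eq_sym ac eq_sym bc.
Qed.

(* The vertices 1, ..., 5 are the elements 0, ..., 4 of 'I_5. *)
Definition triple5 (i j k : nat) : {set 'I_5} :=
  [set inord i.-1; inord j.-1; inord k.-1].

Definition F32_edges : {set {set 'I_5}} :=
  [set triple5 1 2 3; triple5 1 4 5; triple5 2 4 5; triple5 3 4 5].

Lemma F32_card3 e : e \in F32_edges -> #|e| = 3.
Proof.
by rewrite !inE -!orbA => /or4P[] /eqP->; apply: cards3;
  rewrite /= !inE -!val_eqE /= !inordK.
Qed.

Definition F32 : graph3 := Graph3 F32_card3.

Definition tight_cycle_edges (l : nat) : {set {set 'I_l}} :=
  [set [set i; ordS i; ordS (ordS i)] | i : 'I_l].

Lemma tight_cycle_card3 l (l_ge3 : 2 < l) e :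
  e \in tight_cycle_edges l -> #|e| = 3.
Proof.
case/imsetP=> i _ ->; apply: cards3.
rewrite /= !inE -!val_eqE /=.
have il := ltn_ord i; have [i1|i1] := ltnP i.+1 l.
  rewrite (modn_small i1); have [i2|i2] := ltnP i.+2 l.
    by rewrite modn_small //; lia.
  have -> : i.+2 = l by lia.
  by rewrite modnn; lia.
have -> : i.+1 = l by lia.
by rewrite modnn modn_small; lia.
Qed.

Definition tight_cycle (l : nat) (l_ge3 : 2 < l) : graph3 :=
  Graph3 (tight_cycle_card3 l_ge3).

Lemma remove_edge_card3 (H : graph3) (e : {set vertex H}) e' :
  e' \in edges H :\ e -> #|e'| = 3.
Proof. by case/setD1P=> _; apply: edges_card3. Qed.

Definition remove_edge (H : graph3) (e : {set vertex H}) : graph3 :=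
  Graph3 (@remove_edge_card3 H e).

Definition C5 : graph3 := tight_cycle (isT : 2 < 5).

(* Rotations of the cycle act transitively on its edges, so the choice of the
   removed edge does not matter up to isomorphism. *)
Definition C5minus : graph3 := @remove_edge C5 (triple5 5 1 2).

(* Main.v *)
Require Import Defs.
From Stdlib Require Import ZArith.
From mathcomp Require Import all_boot all_order all_algebra.
From mathcomp Require Import all_classical all_reals all_analysis.
From mathcomp Require Import zify ring lra ssrZ.
Set Implicit Arguments.
Unset Strict Implicit.
Unset Printing Implicit Defensive.
Import Order.TTheory GRing.Theory Num.Theory.
Import numFieldNormedType.Exports.
Delimit Scope Z_scope with Z.

(** Write [K4-] for three of the four triples on four points: an apex joined to
    the three pairs of a base.

    Upper bound 2/9.  The only two vertices of [C5minus] in no common edge are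
    the second and the fifth, and identifying them turns [C5minus] into [K4-].
    So in a [C5minus]-free 3-graph every base has at most one apex: two apexes
    over the same base would form a [C5minus].  Hence an n-vertex graph has at
    most n^3 labelled [K4-], and all but O(n^5) of its ordered 6-tuples of
    vertices span none.  Such a 6-tuple, repetitions allowed, pulls the edges
    back to a triple system on six indices that receives no homomorphism from
    [F32], [C5minus] or [K4-]; call such systems admissible.  For them a flag
    algebra certificate holds: a polynomial in the edge indicators, equal to a
    positive combination of squares (after averaging over the last vertices)
    plus a multiple of (edge density - 2/9), has a nonpositive sum over the 720
    orderings of the six points ([sym_certificate_le0]).  Summing over all 6-tuples, the
    squares contribute a nonnegative amount ([sum_certificate_ge]), and
    e(G) <= n^3/27 + O(n^2) follows ([ordered_edges_le]).

    The inequality on six points is decided by computation.  Up to relabelling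
    there are eight admissible systems on five points; every admissible system
    on six points extends one of them by a vertex of minimum degree, which
    leaves 142 systems to evaluate.

    Deleting a vertex and averaging shows that ex(n)/C(n,3) is nonincreasing
    from n = 3 on, so the limit defining the density exists, is at most every
    term, and is at least any number that infinitely many terms reach
    ([turan_density_le], [turan_density_ge]).

    Lower bounds come from blow-ups: a blow-up of a triple system contains a
    graph only if the graph maps to the system.  Blow-ups of a single edge give
    2/9 for the pair.  Every two vertices of [F32] lie in a common edge, so
    [F32] does not map to [K4-], whose blow-ups have density 18/64 > 2/9.
    [C5minus] does not map to [F32], whose blow-up with weights 1,1,1,3,3 has
    density 168/729 > 2/9. *)

(** * Triple systems as ternary relations *)

Definition ternary (T : Type) := T -> T -> T -> bool.

Definition triple_system T (H : ternary T) : Prop :=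
  [/\ forall a b c, H a b c = H b a c, forall a b c, H a b c = H a c b
    & forall a b, H a a b = false].

(** The three freeness conditions forbid homomorphic images, so their vertices
    are not required to be distinct; this makes them stable under [pull].  In a
    triple system [K4-] and [F32] have only injective images anyway, since every
    two of their vertices lie in an edge. *)
Definition K4minus_free T (H : ternary T) : Prop :=
  forall a b c d, H a b c -> H a b d -> H a c d -> False.

Definition C5minus_free T (H : ternary T) : Prop :=
  forall a b c d e, H a b c -> H b c d -> H c d e -> H d e a -> False.

Definition F32_free T (H : ternary T) : Prop :=
  forall a b c d e, H a b c -> H a d e -> H b d e -> H c d e -> False.

Definition locally_free T (H : ternary T) : Prop :=
  [/\ triple_system H, K4minus_free H, C5minus_free H & F32_free H].

(** For a non-injective [f] this is a blow-up: indices with the same image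
    become twins, and no edge contains two of them. *)
Definition pull U T (f : U -> T) (H : ternary T) : ternary U :=
  fun a b c => H (f a) (f b) (f c).

Lemma pull_triple_system U T (f : U -> T) H :
  triple_system H -> triple_system (pull f H).
Proof. by case=> s12 s23 irr; split=> *; rewrite /pull ?irr // ?s12 // s23. Qed.

Lemma pull_locally_free U T (f : U -> T) H :
  locally_free H -> locally_free (pull f H).
Proof.
case=> ts k4 c5 f32; split; first exact: pull_triple_system.
- by move=> a b c d; apply: k4.
- by move=> a b c d e; apply: c5.
- by move=> a b c d e; apply: f32.
Qed.

(** * The certificate on six points *)

Definition bit (b : bool) : Z := if b then 1%Z else 0%Z.

(** The coefficients below come from a semidefinite program: they are a rounded
    solution of the flag algebra relaxation for admissible systems on six
    points.  The extremal object is the balanced complete tripartite system,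
    where all inequalities must be tight: each squared linear form averages to
    zero there, whether [x] and [y] are in the same part (codegree 0, common
    link density 2/9) or in different parts (codegree 1/3, common link empty). *)
Section Certificate.

Variables (T : Type) (H : ternary T).
Local Open Scope ring_scope.

(** A linear form in the densities of the two-point extensions of a pair [x y],
    symmetrised in the two added points [u] and [v]. *)
Definition pair_form (a2 a1 al ad ac a0 : Z) x y u v : Z :=
  let c := bit (H x y u) + bit (H x y v) in
  let d := bit (H x u v) + bit (H y u v) in
  a2 * (bit (H x y u) * bit (H x y v)) + a1 * (c * d)
  + al * (bit (H x u v) * bit (H y u v)) + ad * d + ac * c + a0.

Definition form1 := pair_form 6%Z 3%Z (-9)%Z 0%Z (-6)%Z 2%Z.
Definition form2 := pair_form 12%Z 3%Z (-12)%Z 6%Z (-8)%Z 0%Z.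
Definition form3 := pair_form 12%Z 15%Z (-36)%Z 0%Z (-24)%Z 8%Z.
Definition form4 := pair_form 18%Z 0%Z (-9)%Z 9%Z (-6)%Z (-2)%Z.

Definition degree_gap x y u v : Z := bit (H x u v) - bit (H y u v).

(** For two edges [x y u] and [x y v], compares the codegrees of the pairs joining
    [u] to the spine [x y] with those joining [v] to it. *)
Definition codegree_gap x y u v w : Z :=
  (bit (H x u w) + bit (H y u w)) - (bit (H x v w) + bit (H y v w)).

(** Each product is a square once [u' v'] are summed over like [u v] (in the last
    one, once [u'] and [v'] are), and the final terms average to
    6912 (edge density - 2/9). *)
Definition certificate x y u v u' v' : Z :=
  256%Z * (form1 x y u v * form1 x y u' v')
  + 117%Z * (form2 x y u v * form2 x y u' v')
  + 7%Z * (form3 x y u v * form3 x y u' v')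
  + 16%Z * (form4 x y u v * form4 x y u' v')
  + 5724%Z * (degree_gap x y u v * degree_gap x y u' v')
  + 20736%Z * (bit (H x y u) * bit (H x y v)
               * (codegree_gap x y u v u' * codegree_gap x y u v v'))
  + 3456%Z * (bit (H x y u) + bit (H x y v)) - 1536%Z.

End Certificate.

Definition certificate_at (H : ternary nat) (s : seq nat) : Z :=
  certificate H (nth 0 s 0) (nth 0 s 1) (nth 0 s 2) (nth 0 s 3) (nth 0 s 4) (nth 0 s 5).

(** * Reduction to one eighth of the orderings *)

Definition orderings6 := permutations (iota 0 6).

Definition sym_certificate (H : ternary nat) : Z :=
  (\sum_(s <- orderings6) certificate_at H s)%R.

Lemma mem_orderings6 s : (s \in orderings6) = perm_eq s (iota 0 6).
Proof. exact: mem_permutations. Qed.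

Lemma size_orderings6 s : s \in orderings6 -> size s = 6.
Proof. by rewrite mem_orderings6 => /perm_size ->; rewrite size_iota. Qed.

Lemma perm_map_self (T : eqType) (r : seq T) (g : T -> T) :
  uniq r -> {in r &, injective g} -> {in r, forall x, g x \in r} ->
  perm_eq [seq g x | x <- r] r.
Proof.
move=> u inj sub.
have um : uniq [seq g x | x <- r] by rewrite map_inj_in_uniq.
have sub' : {subset [seq g x | x <- r] <= r} by move=> _ /mapP[x x_in ->]; apply: sub.
have [_ eq_mem] := uniq_min_size um sub' (eq_leq (esym (size_map g r))).
exact: uniq_perm.
Qed.

(** An involution of the index set that preserves the summand and exchanges
    [P] with its complement pairs the terms. *)
Lemma sum_halve (V : zmodType) (I : eqType) (r : seq I) (g : I -> I) (P : pred I) (F : I -> V) :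
  perm_eq [seq g i | i <- r] r ->
  {in r, forall i, P (g i) = ~~ P i} -> {in r, forall i, F (g i) = F i} ->
  (\sum_(i <- r) F i = (\sum_(i <- r | P i) F i) *+ 2)%R.
Proof.
move=> rg Pg Fg; rewrite mulr2n (bigID P) /=; congr (_ + _)%R.
transitivity (\sum_(i <- [seq g i | i <- r] | ~~ P i) F i)%R.
  by apply: perm_big; rewrite perm_sym.
rewrite big_map big_seq_cond [RHS]big_seq_cond.
apply: eq_big => [i|i /andP[/Fg]] //=.
by case i_in: (i \in r) => //=; rewrite Pg // negbK.
Qed.

Definition swap_next j i : nat := if i == j then j.+1 else if i == j.+1 then j else i.

Definition swap_entries j (s : seq nat) : seq nat :=
  [seq nth 0 s (swap_next j i) | i <- iota 0 6].

Definition ascent j (s : seq nat) : bool := nth 0 s j < nth 0 s j.+1.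

Lemma sum_ascent (V : zmodType) j (F : seq nat -> V) : j.+1 < 6 ->
  (forall s, F (swap_entries j s) = F s) ->
  (\sum_(s <- orderings6) F s =
   (\sum_(s <- orderings6) if ascent j s then F s else 0) *+ 2)%R.
Proof.
move=> j6 Fswap.
have perm_swap : perm_eq [seq swap_next j i | i <- iota 0 6] (iota 0 6).
  by case: j j6 {Fswap} => [|[|[|[|[|]]]]].
have swapK s : s \in orderings6 -> swap_entries j (swap_entries j s) = s.
  move=> /size_orderings6; case: s => [|a [|b [|c [|d [|e [|f [|]]]]]]] // _.
  by case: j j6 {Fswap perm_swap} => [|[|[|[|[|]]]]].
rewrite -big_mkcond; apply: (@sum_halve _ _ _ (swap_entries j)) => //.
- apply: perm_map_self; first exact: permutations_uniq.
    by apply: (can_in_inj swapK).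
  move=> s s_in; rewrite mem_orderings6 /swap_entries (map_comp (nth 0 s)).
  rewrite (perm_trans (perm_map _ perm_swap)) //.
  have := s_in; rewrite mem_orderings6; congr (perm_eq _ _).
  by rewrite -[LHS](mkseq_nth 0) /mkseq (size_orderings6 s_in).
move=> s s_in; have sz := size_orderings6 s_in.
have us : uniq s by move: s_in; rewrite mem_orderings6 => /perm_uniq ->.
rewrite /ascent /swap_entries !(nth_map 0) ?size_iota ?nth_iota ?add0n //; try lia.
rewrite /swap_next !eqxx (_ : (j.+1 == j) = false); last lia.
have : nth 0 s j != nth 0 s j.+1 by rewrite nth_uniq ?sz //; lia.
lia.
Qed.

Lemma pair_formC T (H : ternary T) (ts : triple_system H) a b c d e f x y u v :
  pair_form H a b c d e f y x u v = pair_form H a b c d e f x y u v.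
Proof.
have [s12 s23 _] := ts.
by rewrite /pair_form (s12 y x) (s12 y x v); set l := bit _; ring.
Qed.

Lemma pair_formCr T (H : ternary T) (ts : triple_system H) a b c d e f x y u v :
  pair_form H a b c d e f x y v u = pair_form H a b c d e f x y u v.
Proof.
have [s12 s23 _] := ts.
rewrite /pair_form (s23 x v) (s23 y v).
move: (bit _) (bit _) (bit _) (bit _) => p q r s; ring.
Qed.

Lemma certificate_swap01 T (H : ternary T) (ts : triple_system H) x y u v u' v' :
  certificate H y x u v u' v' = certificate H x y u v u' v'.
Proof.
have [s12 s23 _] := ts.
rewrite /certificate /form1 /form2 /form3 /form4 !(pair_formC ts _ _ _ _ _ _ x y).
rewrite /degree_gap /codegree_gap (s12 y x) (s12 y x v).
repeat move: (pair_form _ _ _ _ _ _ _ _ _ _ _) => ?.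
repeat move: (bit _) => ?; ring.
Qed.

Lemma certificate_swap23 T (H : ternary T) (ts : triple_system H) x y u v u' v' :
  certificate H x y v u u' v' = certificate H x y u v u' v'.
Proof.
have [s12 s23 _] := ts.
rewrite /certificate /form1 /form2 /form3 /form4 !(pair_formCr ts _ _ _ _ _ _ x y u v).
rewrite /degree_gap /codegree_gap (s23 x v u) (s23 y v u).
repeat move: (pair_form _ _ _ _ _ _ _ _ _ _ _) => ?.
repeat move: (bit _) => ?; ring.
Qed.

Lemma certificate_swap45 T (H : ternary T) (ts : triple_system H) x y u v u' v' :
  certificate H x y u v v' u' = certificate H x y u v u' v'.
Proof.
have [s12 s23 _] := ts.
rewrite /certificate /form1 /form2 /form3 /form4 !(pair_formCr ts _ _ _ _ _ _ x y u' v').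
rewrite /degree_gap (s23 x v' u') (s23 y v' u').
repeat move: (pair_form _ _ _ _ _ _ _ _ _ _ _) => ?.
repeat move: (codegree_gap _ _ _ _ _ _) => ?.
repeat move: (bit _) => ?; ring.
Qed.

Definition sumZ (s : seq Z) : Z := foldr Z.add 0%Z s.

Lemma sumZ_map (I : Type) (r : seq I) (F : I -> Z) :
  sumZ [seq F i | i <- r] = (\sum_(i <- r) F i)%R.
Proof. by elim: r => [|i r IHr]; rewrite ?big_nil // big_cons -IHr. Qed.

Definition ascending_orderings6 :=
  [seq s <- orderings6 | ascent 4 s && (ascent 2 s && ascent 0 s)].

(** The certificate is invariant under the three transpositions of [x y], [u v] and
    [u' v'], so only orderings increasing on each of these pairs need evaluating. *)
Lemma sym_certificate_ascending H : triple_system H ->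
  sym_certificate H =
    (sumZ [seq certificate_at H s | s <- ascending_orderings6] *+ 8)%R.
Proof.
move=> ts.
rewrite sumZ_map big_filter (@big_mkcond _ _ _ _ _ (fun s => _ && _)) /sym_certificate.
rewrite (@sum_ascent _ 0) //; last first.
  by move=> s; apply: certificate_swap01.
rewrite (@sum_ascent _ 2) //; last first.
  by move=> s; rewrite /ascent /certificate_at /= certificate_swap23.
rewrite (@sum_ascent _ 4) //; last first.
  by move=> s; rewrite /ascent /certificate_at /= certificate_swap45.
rewrite -!mulrnA; congr (_ *+ _)%R; apply: eq_bigr => s _.
by do 2![case: (ascent _ s) => //=].
Qed.

(** * Enumeration of one-point extensions *)

Definition pairs n := [seq (a, b) | b <- iota 0 n, a <- iota 0 b].

(** Colexicographic order: the triples below [n.+1] are those below [n] followed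
    by those with largest entry [n], so edge lists grow by appending links. *)
Definition triples n := flatten [seq [seq (p, c) | p <- pairs c] | c <- iota 0 n].

Definition edge_list n (H : ternary nat) :=
  [seq t <- triples n | H t.1.1 t.1.2 t.2].

Definition sort3 a b c : nat * nat * nat :=
  let: (x, y) := if a <= b then (a, b) else (b, a) in
  if c <= x then (c, x, y) else if c <= y then (x, c, y) else (x, y, c).

Definition adj (g : seq (nat * nat * nat)) : ternary nat :=
  fun a b c => sort3 a b c \in g.

Lemma mem_pairs n a b : ((a, b) \in pairs n) = (a < b < n).
Proof.
apply/allpairsPdep/idP => [[y [x []]]|/andP[ab bn]].
  by rewrite !mem_iota /= !add0n => yn xy [-> ->]; rewrite xy yn.
by exists b, a; rewrite !mem_iota /= !add0n bn ab.
Qed.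

Lemma mem_triples n a b c : ((a, b, c) \in triples n) = [&& a < b, b < c & c < n].
Proof.
apply/flatten_mapP/idP => [[z]|/and3P[ab bc cn]].
  rewrite mem_iota add0n => zn /mapP[[x y]]; rewrite mem_pairs => /andP[xy yz] [-> -> ->].
  by rewrite xy yz.
exists c; first by rewrite mem_iota.
by apply: map_f; rewrite mem_pairs ab bc.
Qed.

Lemma edge_listS n H :
  edge_list n.+1 H =
    edge_list n H ++ [seq (p, n) | p <- [seq p <- pairs n | H p.1 p.2 n]].
Proof.
rewrite /edge_list /triples -addn1 iotaD add0n map_cat flatten_cat filter_cat.
by rewrite /= cats0 filter_map.
Qed.

Lemma eq_edge_list n (H H' : ternary nat) :
  (forall a b c, a < n -> b < n -> c < n -> H a b c = H' a b c) ->
  edge_list n H = edge_list n H'.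
Proof.
move=> eqH; apply: eq_in_filter => -[[a b] c]; rewrite mem_triples /= => abc.
by apply: eqH; lia.
Qed.

Lemma adj_edge_list n H a b c : triple_system H -> a < n -> b < n -> c < n ->
  adj (edge_list n H) a b c = H a b c.
Proof.
move=> [s12 s23 irr] an bn cn.
have irr23 x y : H x y y = false by rewrite s12 s23 irr.
have sorted_case x y z : x <= y -> y <= z -> z < n ->
    ((x, y, z) \in edge_list n H) = H x y z.
  move=> xy yz zn; rewrite mem_filter mem_triples /= zn andbT.
  have [->|xNy] := eqVneq x y; first by rewrite irr.
  have [->|yNz] := eqVneq y z; first by rewrite irr23.
  by rewrite !ltn_neqAle xNy yNz xy yz !andbT.
rewrite /adj /sort3.
by case: (leqP a b) => ab; case: leqP => c1; try case: leqP => c2;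
  (rewrite sorted_case; [|lia..]);
  first [done|by rewrite s12|by rewrite s23|by rewrite s12 s23
        |by rewrite s23 s12|by rewrite s12 s23 s12].
Qed.

(** Makes evaluation fast: an edge list is searched once for each triple, and
    later queries read off a nested table. *)
Definition table n (H : ternary nat) :=
  mkseq (fun a => mkseq (fun b => mkseq (H a b) n) n) n.

Definition lookup (t : seq (seq (seq bool))) : ternary nat :=
  fun a b c => nth false (nth [::] (nth [::] t a) b) c.

Lemma lookup_table n H a b c : a < n -> b < n -> c < n ->
  lookup (table n H) a b c = H a b c.
Proof. by move=> an bn cn; rewrite /lookup !nth_mkseq. Qed.

Definition tabulate n (g : seq (nat * nat * nat)) : ternary nat :=
  lookup (table n (adj g)).

Lemma tabulate_edge_list n H a b c : triple_system H -> a < n -> b < n -> c < n ->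
  tabulate n (edge_list n H) a b c = H a b c.
Proof. by move=> ts an bn cn; rewrite /tabulate lookup_table // adj_edge_list. Qed.

(** With [p] and the pairs of [L] joined to a new vertex, a [K4-] using [p] has as
    apex either the new vertex (a triangle in the link) or an end of [p] (two
    adjacent link pairs inside an edge of [H]). *)
Definition addable n (H : ternary nat) (L : seq (nat * nat)) (p : nat * nat) :=
  all (fun c =>
    let pa := ((p.1, c) \in L) || ((c, p.1) \in L) in
    let pb := ((p.2, c) \in L) || ((c, p.2) \in L) in
    ~~ ((pa && pb) || ((pa || pb) && H p.1 p.2 c))) (iota 0 n).

Definition links n (H : ternary nat) : seq (seq (nat * nat)) :=
  foldr (fun p Ls => Ls ++ [seq p :: L | L <- Ls & addable n H L p]) [:: [::]] (pairs n).

(** Adding the pairs of a [K4-]-free link one at a time never meets the [addable]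
    obstruction, so the true link survives the pruning. *)
Lemma mem_links n (H K : ternary nat) : triple_system K -> K4minus_free K ->
  (forall a b c, a < n -> b < n -> c < n -> H a b c = K a b c) ->
  [seq p <- pairs n | K p.1 p.2 n] \in links n H.
Proof.
move=> [s12 s23 _] k4 eqHK; rewrite /links.
have : {subset pairs n <= pairs n} by [].
elim: {1 3 4}(pairs n) => [|[a b] ps IHps] sub //=.
have {}IHps := IHps (fun p p_in => sub p (mem_behead (s := (a, b) :: ps) p_in)).
have abn : a < b < n by rewrite -mem_pairs sub // mem_head.
rewrite mem_cat; case Kabn: (K a b n); last by rewrite IHps.
apply/orP; right; apply: map_f; rewrite mem_filter IHps andbT.
apply/allP => c; rewrite mem_iota /= add0n => cn.
have inL x y : ((x, y) \in [seq p <- ps | K p.1 p.2 n]) ||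
    ((y, x) \in [seq p <- ps | K p.1 p.2 n]) -> K x y n.
  by rewrite !mem_filter /= (s12 y x) => /orP[] /andP[].
apply/negP => /orP[/andP[/inL Kac /inL Kbc]|/andP[]].
  by apply: (k4 n a b c); rewrite s12 s23 // ?Kabn ?Kac ?Kbc.
rewrite eqHK //; try lia; move=> /orP[/inL Kac|/inL Kbc] Kabc.
  exact: (k4 a b c n).
by apply: (k4 b a c n); rewrite // s12.
Qed.

Definition extensions n (g : seq (nat * nat * nat)) :=
  [seq g ++ [seq (p, n) | p <- L] | L <- links n (tabulate n g)].

Lemma mem_extensions n (H : ternary nat) : triple_system H -> K4minus_free H ->
  edge_list n.+1 H \in extensions n (edge_list n H).
Proof.
move=> ts k4; rewrite edge_listS.
apply: (map_f (fun L => edge_list n H ++ [seq (p, n) | p <- L])).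
by apply: mem_links => // *; apply: tabulate_edge_list.
Qed.

(** The tests below filter before they quantify further, which keeps the search
    short under call-by-value evaluation. *)
Definition pentagon_free n (H : ternary nat) :=
  let I := iota 0 n in
  all (fun a => all (fun b => all (fun c => all (fun d =>
    nilp [seq e <- I | H c d e && H d e a])
    [seq d <- I | H b c d]) [seq c <- I | H a b c]) I) I.

Definition independent_neighborhoods n (H : ternary nat) :=
  let I := iota 0 n in
  all (fun d => all (fun e => let N := [seq x <- I | H x d e] in
    all (fun a => all (fun b => nilp [seq c <- N | H a b c]) N) N) I) I.

Lemma nilp_filterP (T : eqType) (P : pred T) s :
  reflect (forall x, x \in s -> P x -> False) (nilp [seq x <- s | P x]).
Proof.
apply: (iffP idP) => [nil x xs Px|no].
  have : x \in [seq x <- s | P x] by rewrite mem_filter Px.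
  by move/nilP: nil => ->.
apply/nilP/eqP; rewrite -[_ == _]negbK -has_filter; apply/hasPn => x xs.
by apply/negP => /no-/(_ xs).
Qed.

Lemma pentagon_freeT n H K : C5minus_free K ->
  (forall a b c, a < n -> b < n -> c < n -> H a b c = K a b c) ->
  pentagon_free n H.
Proof.
move=> c5 eqHK.
apply/allP => a; rewrite mem_iota /= => an; apply/allP => b; rewrite mem_iota /= => bn.
apply/allP => c; rewrite mem_filter mem_iota /= => /andP[abc cn].
apply/allP => d; rewrite mem_filter mem_iota /= => /andP[bcd dn].
apply/nilp_filterP => e; rewrite mem_iota /= => en; rewrite !eqHK // in abc bcd *.
by case/andP; apply: c5 abc bcd.
Qed.

Lemma independent_neighborhoodsT n H K : F32_free K ->
  (forall a b c, a < n -> b < n -> c < n -> H a b c = K a b c) ->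
  independent_neighborhoods n H.
Proof.
move=> f32 eqHK.
apply/allP => d; rewrite mem_iota /= => dn; apply/allP => e; rewrite mem_iota /= => en.
apply/allP => a; rewrite mem_filter mem_iota /= => /andP[ade an].
apply/allP => b; rewrite mem_filter mem_iota /= => /andP[bde bn].
apply/nilp_filterP => c; rewrite mem_filter mem_iota /= => /andP[cde cn].
by rewrite !eqHK // in ade bde cde *; move=> abc; apply: f32 abc ade bde cde.
Qed.

(** * Classification on five points *)

Definition permutes n (f : nat -> nat) := perm_eq [seq f i | i <- iota 0 n] (iota 0 n).

Lemma permutes_lt n f i : permutes n f -> i < n -> f i < n.
Proof.
move=> /perm_mem fP i_n; have := fP (f i); rewrite mem_iota add0n /= => <-.
by apply: map_f; rewrite mem_iota.
Qed.

Lemma permutes_inj n f : permutes n f -> {in gtn n &, injective f}.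
Proof.
move=> fP i j; rewrite !inE => i_n j_n fij.
have u : uniq [seq f i | i <- iota 0 n] by rewrite (perm_uniq fP) iota_uniq.
have := nth_uniq 0 _ _ u; rewrite size_map size_iota => /(_ i j i_n j_n).
by rewrite !(nth_map 0) ?size_iota // !nth_iota // !add0n fij eqxx => /esym/eqP.
Qed.

Lemma permutes_nth n s : s \in permutations (iota 0 n) -> permutes n (nth 0 s).
Proof.
rewrite mem_permutations => sn; rewrite /permutes.
have sz : size s = n by rewrite (perm_size sn) size_iota.
by rewrite -{1}sz map_nth_iota0 // take_size.
Qed.

Lemma permutes_comp n f g : permutes n f -> permutes n g -> permutes n (f \o g).
Proof.
by move=> fP gP; rewrite /permutes (map_comp f g); apply: (perm_trans _ fP); apply: perm_map.
Qed.

Definition fix_from n (f : nat -> nat) i := if i < n then f i else i.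

Lemma permutes_fix_from n f : permutes n f -> permutes n.+1 (fix_from n f).
Proof.
move=> fP; rewrite /permutes -addn1 iotaD map_cat /= add0n {2}/fix_from ltnn.
rewrite perm_cat2r (_ : [seq _ | i <- iota 0 n] = [seq f i | i <- iota 0 n]) //.
by apply/eq_in_map => i; rewrite mem_iota /fix_from => /andP[_ ->].
Qed.

Definition complete_list n (R : seq (seq (nat * nat * nat))) : Prop :=
  forall H, locally_free H ->
  exists2 f, permutes n f & edge_list n (pull f H) \in R.

Definition free_test n (H : ternary nat) :=
  pentagon_free n H && independent_neighborhoods n H.

Definition extends_to n (R R' : seq (seq (nat * nat * nat))) : bool :=
  all (fun g => all (fun g' =>
    let H := tabulate n.+1 g' in
    has (fun s => edge_list n.+1 (pull (nth 0 s) H) \in R')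
        (permutations (iota 0 n.+1)))
    [seq g' <- extensions n g | free_test n.+1 (tabulate n.+1 g')]) R.

Lemma free_test_tabulate n H : locally_free H -> free_test n (tabulate n (edge_list n H)).
Proof.
move=> [ts _ c5 f32].
by apply/andP; split; [apply: pentagon_freeT c5 _|apply: independent_neighborhoodsT f32 _];
  move=> *; apply: tabulate_edge_list.
Qed.

(** A system on [n.+1] points can be relabelled so that its restriction to the
    first [n] points is one of the list; it is then literally one of the computed
    extensions. *)
Lemma complete_list_extend n R R' :
  extends_to n R R' -> complete_list n R -> complete_list n.+1 R'.
Proof.
move=> /allP RR' cR H lfH; have [f fP fR] := cR H lfH.
set f' := fix_from n f; set H' := pull f' H.
have lfH' : locally_free H' by apply: pull_locally_free.
have eqn : edge_list n H' = edge_list n (pull f H).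
  by apply: eq_edge_list => a b c an bn cn; rewrite /H' /pull /f' /fix_from an bn cn.
have /allP := RR' _ fR; rewrite -eqn => /(_ (edge_list n.+1 H')).
rewrite mem_filter free_test_tabulate // mem_extensions; [|by case: lfH'..].
move=> /(_ isT)/hasP[s sP sR]; exists (f' \o nth 0 s).
  by apply: permutes_comp (permutes_nth sP); apply: permutes_fix_from.
rewrite -(eq_edge_list (H := pull (nth 0 s) (tabulate n.+1 (edge_list n.+1 H')))) //.
move=> a b c an bn cn; rewrite /pull /=.
by rewrite tabulate_edge_list ?(permutes_lt (permutes_nth sP)) //; case: lfH'.
Qed.

Definition representatives5 : seq (seq (nat * nat * nat)) :=
  [:: [::];
      [:: (0,1,2)];
      [:: (0,1,2); (0,1,3)];
      [:: (0,1,2); (0,1,3); (0,1,4)];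
      [:: (0,1,2); (0,3,4)];
      [:: (0,1,2); (0,1,3); (0,2,4)];
      [:: (0,1,2); (0,1,3); (0,2,4); (0,3,4)];
      [:: (0,1,2); (0,1,3); (2,3,4)]].

Lemma complete_representatives5 : complete_list 5 representatives5.
Proof.
have c0 : complete_list 0 [:: [::]] by move=> H _; exists id.
have c1 : complete_list 1 [:: [::]] by apply: complete_list_extend c0; vm_compute.
have c2 : complete_list 2 [:: [::]] by apply: complete_list_extend c1; vm_compute.
have c3 : complete_list 3 [:: [::]; [:: (0,1,2)]].
  by apply: complete_list_extend c2; vm_compute.
have c4 : complete_list 4 [:: [::]; [:: (0,1,2)]; [:: (0,1,2); (0,1,3)]].
  by apply: complete_list_extend c3; vm_compute.
by apply: complete_list_extend c4; vm_compute.
Qed.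

(** * The inequality on six points *)

Definition degree6 (H : ternary nat) v := count (fun p => H p.1 p.2 v) (pairs 6).

(** Summing over ordered pairs makes the degree visibly invariant under
    relabelling. *)
Lemma double_degree6 H v : triple_system H ->
  (degree6 H v).*2 = \sum_(a <- iota 0 6) \sum_(b <- iota 0 6) H a b v.
Proof.
move=> [s12 _ irr]; rewrite /degree6 /= !big_cons !big_nil !irr.
rewrite !(s12 5) !(s12 4 0) !(s12 4 1) !(s12 4 2) !(s12 4 3) !(s12 3 0) !(s12 3 1) !(s12 3 2).
rewrite !(s12 2 0) !(s12 2 1) (s12 1 0).
rewrite [nat_of_bool false]/=; repeat move: (nat_of_bool (H _ _ _)) => ?; lia.
Qed.

Lemma degree6_pull f H v : triple_system H -> permutes 6 f ->
  degree6 (pull f H) v = degree6 H (f v).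
Proof.
move=> ts fP; apply: double_inj; rewrite !double_degree6 //; last exact: pull_triple_system.
rewrite -[RHS](perm_big _ fP) big_map; apply: eq_bigr => a _.
by rewrite -[RHS](perm_big _ fP) big_map.
Qed.

Lemma certificate_pull U T (f : U -> T) H x y u v u' v' :
  certificate (pull f H) x y u v u' v' =
  certificate H (f x) (f y) (f u) (f v) (f u') (f v').
Proof.
by rewrite /certificate /form1 /form2 /form3 /form4 /pair_form
           /degree_gap /codegree_gap /pull.
Qed.

Lemma sym_certificate_pull f H : permutes 6 f ->
  sym_certificate (pull f H) = sym_certificate H.
Proof.
move=> fP; rewrite /sym_certificate.
have sz := @size_orderings6.
have lt6 s i : s \in orderings6 -> i < 6 -> nth 0 s i < 6.
  by move=> sP; apply: permutes_lt; apply: permutes_nth.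
have fself : perm_eq [seq [seq f i | i <- s] | s <- orderings6] orderings6.
  apply: perm_map_self; first exact: permutations_uniq.
    move=> s t sP tP eqst; apply: (@eq_from_nth _ 0); first by rewrite !sz.
    move=> i; rewrite (sz s sP) => i6; apply: (permutes_inj fP); rewrite ?inE ?lt6 //.
    by rewrite -!(nth_map 0 0 f) ?sz // eqst.
  move=> s; rewrite !mem_orderings6 => sP.
  by apply: (perm_trans _ fP); apply: perm_map.
rewrite -[RHS](perm_big _ fself) big_map; apply: eq_big_seq => s sP.
rewrite /certificate_at certificate_pull.
by rewrite !(nth_map 0) ?(sz s sP).
Qed.

Definition last_degree_min (g : seq (nat * nat * nat)) : bool :=
  let d := degree6 (adj g) 5 in all (fun v => d <= degree6 (adj g) v) (iota 0 6).

Definition certificate_check : bool :=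
  let orders := ascending_orderings6 in
  all (fun g => all (fun g' =>
      let H := tabulate 6 g' in
      Z.leb (sumZ [seq certificate_at H s | s <- orders]) 0)
    [seq g' <- [seq g' <- extensions 5 g | last_degree_min g'] |
       free_test 6 (tabulate 6 g')]) representatives5.

Lemma certificate_checkT : certificate_check = true.
Proof. by vm_compute. Qed.

Lemma eq_certificate_at (H H' : ternary nat) s : s \in orderings6 ->
  (forall a b c, a < 6 -> b < 6 -> c < 6 -> H a b c = H' a b c) ->
  certificate_at H s = certificate_at H' s.
Proof.
move=> /permutes_nth sP eqH; have lt6 i := permutes_lt sP (i := i).
rewrite /certificate_at /certificate /form1 /form2 /form3 /form4 /pair_form.
by rewrite /degree_gap /codegree_gap !eqH ?lt6.
Qed.

Lemma permutes_swap v : v < 6 ->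
  permutes 6 (fun i => if i == v then 5 else if i == 5 then v else i).
Proof. by case: v => [|[|[|[|[|[|]]]]]]. Qed.

(** Relabelling preserves admissibility and the sum, so a vertex of minimum degree may be placed
    last and the other five points put in the form of a representative. *)
Lemma sym_certificate_le0 H : locally_free H -> (sym_certificate H <= 0)%R.
Proof.
move=> lfH.
have [v vmin] : exists v : 'I_6, forall w : 'I_6, degree6 H v <= degree6 H w.
  case: (@arg_minnP 'I_6 ord0 xpredT (degree6 H) isT) => v _ vmin.
  by exists v => w; apply: vmin.
pose f1 i := if i == v :> nat then 5 else if i == 5 then v : nat else i.
have f1P : permutes 6 f1 by apply: permutes_swap.
rewrite -(sym_certificate_pull _ f1P).
set H1 := pull f1 H; have lf1 : locally_free H1 by apply: pull_locally_free.
have [ts ts1] : triple_system H /\ triple_system H1 by case: lfH; case: lf1.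
have min1 i : i < 6 -> degree6 H1 5 <= degree6 H1 i.
  move=> i6; have degH1 j : degree6 H1 j = degree6 H (f1 j) by apply: degree6_pull.
  rewrite !degH1; have -> : f1 5 = v by rewrite /f1 eqxx; case: eqP.
  exact: (vmin (Ordinal (permutes_lt f1P i6))).
have [f2 f2P f2R] := complete_representatives5 lf1.
set f3 := fix_from 5 f2; have f3P : permutes 6 f3 by apply: permutes_fix_from.
rewrite -(sym_certificate_pull _ f3P); set H3 := pull f3 H1.
have lf3 : locally_free H3 by apply: pull_locally_free.
have ts3 : triple_system H3 by case: lf3.
have eq5 : edge_list 5 H3 = edge_list 5 (pull f2 H1).
  by apply: eq_edge_list => a b c an bn cn; rewrite /H3 /pull /f3 /fix_from an bn cn.
have min3 i : i < 6 -> degree6 H3 5 <= degree6 H3 i.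
  move=> i6; have degH3 j : degree6 H3 j = degree6 H1 (f3 j) by apply: degree6_pull.
  by rewrite !degH3; apply: min1; apply: permutes_lt f3P i6.
have adj3 i : i < 6 -> degree6 (adj (edge_list 6 H3)) i = degree6 H3 i.
  move=> i6; apply: eq_in_count => -[a b]; rewrite mem_pairs /= => ab.
  by apply: adj_edge_list => //; lia.
have := certificate_checkT; rewrite /certificate_check.
move=> /allP/(_ _ f2R)/allP; rewrite -eq5 => /(_ (edge_list 6 H3)).
rewrite !mem_filter free_test_tabulate // mem_extensions; [|by case: lf3..].
have -> : last_degree_min (edge_list 6 H3).
  by apply/allP => i; rewrite mem_iota add0n => /= i6; rewrite !adj3 // min3.
move=> /(_ isT); cbv beta zeta.
have -> : [seq certificate_at (tabulate 6 (edge_list 6 H3)) s | s <- ascending_orderings6]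
        = [seq certificate_at H3 s | s <- ascending_orderings6].
  apply/eq_in_map => s; rewrite mem_filter => /andP[_ sP].
  by apply: eq_certificate_at => // *; apply: tabulate_edge_list.
rewrite sym_certificate_ascending //; move: (sumZ _) => z z_le0.
by rewrite mulrn_wle0.
Qed.

(** * Averaging over tuples of vertices *)

Lemma sum_tuple_cons (V : finType) (A : zmodType) n (F : n.+1.-tuple V -> A) :
  (\sum_t F t = \sum_x \sum_(t : n.-tuple V) F [tuple of x :: t])%R.
Proof.
rewrite pair_bigA /= (reindex (fun p : V * n.-tuple V => [tuple of p.1 :: p.2])) //=.
exists (fun t : n.+1.-tuple V => (thead t, [tuple of behead t])) => [[x t]|t] _ /=.
  by congr (_, _); apply: val_inj.
by rewrite -tuple_eta.
Qed.

(** Out-of-range indices read the first entry, so that [entry t] is a total map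
    whose values are entries of [t]. *)
Definition entry (V : Type) n (t : n.+1.-tuple V) (i : nat) : V := nth (thead t) t i.

Lemma sum_tuple6 (V : finType) (A : zmodType) (F : V -> V -> V -> V -> V -> V -> A) :
  (\sum_(t : 6.-tuple V)
     F (entry t 0) (entry t 1) (entry t 2) (entry t 3) (entry t 4) (entry t 5)
   = \sum_x \sum_y \sum_u \sum_v \sum_u' \sum_v' F x y u v u' v')%R.
Proof.
do 6![rewrite sum_tuple_cons; apply: eq_bigr => ? _].
rewrite (big_pred1 [tuple]) // => t; exact/esym/eqP/tuple0.
Qed.

#[local] Arguments Z.mul : simpl never.
#[local] Arguments Z.add : simpl never.
#[local] Arguments Z.opp : simpl never.

Section SumOfCertificate.

Variables (V : finType) (E : ternary V).

Let certificate_tuple (t : 6.-tuple V) : Z :=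
  certificate E (entry t 0) (entry t 1) (entry t 2) (entry t 3) (entry t 4) (entry t 5).

(** For fixed [x y] the sum over [u v] and [u' v'] is the square of the sum over
    [u v]. *)
Lemma sum_square_ge0 (c : Z) (f : V -> V -> V -> V -> Z) : (0 <= c)%R ->
  (0 <= \sum_(t : 6.-tuple V) c * (f (entry t 0) (entry t 1) (entry t 2) (entry t 3)
                       * f (entry t 0) (entry t 1) (entry t 4) (entry t 5)))%R.
Proof.
move=> c0; rewrite -mulr_sumr mulr_ge0 //.
rewrite (sum_tuple6 (fun x y u v u' v' => f x y u v * f x y u' v')%R).
apply: sumr_ge0 => x _; apply: sumr_ge0 => y _.
rewrite (_ : (\sum_u _ = (\sum_u \sum_v f x y u v) ^+ 2)%R) ?sqr_ge0 //.
rewrite expr2 mulr_suml; apply: eq_bigr => u _; rewrite mulr_suml; apply: eq_bigr => v _.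
by rewrite mulr_sumr; apply: eq_bigr => u' _; rewrite mulr_sumr.
Qed.

Lemma sum_codegree_gap_ge0 (c : Z) (b : V -> V -> V -> V -> Z) (f : V -> V -> V -> V -> V -> Z) :
  (0 <= c)%R -> (forall x y u v, 0 <= b x y u v)%R ->
  (0 <= \sum_(t : 6.-tuple V) c * (b (entry t 0) (entry t 1) (entry t 2) (entry t 3) *
        (f (entry t 0) (entry t 1) (entry t 2) (entry t 3) (entry t 4)
       * f (entry t 0) (entry t 1) (entry t 2) (entry t 3) (entry t 5))))%R.
Proof.
move=> c0 b0; rewrite -mulr_sumr mulr_ge0 //.
rewrite (sum_tuple6 (fun x y u v w w' => b x y u v * (f x y u v w * f x y u v w'))%R).
apply: sumr_ge0 => x _; apply: sumr_ge0 => y _.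
apply: sumr_ge0 => u _; apply: sumr_ge0 => v _.
have -> : (\sum_w \sum_w' b x y u v * (f x y u v w * f x y u v w')
           = b x y u v * (\sum_w f x y u v w) ^+ 2)%R; last by rewrite mulr_ge0 ?sqr_ge0.
rewrite expr2 mulrA [(b x y u v * _)%R]mulr_sumr mulr_suml; apply: eq_bigr => w _.
by rewrite mulr_sumr; apply: eq_bigr => w' _; rewrite mulrA.
Qed.

Definition ordered_edges : Z := (\sum_x \sum_y \sum_z bit (E x y z))%R.

Lemma sum_certificate_ge :
  (6912%Z * ordered_edges * #|V|%:R ^+ 3 - 1536%Z * #|V|%:R ^+ 6 <= \sum_t certificate_tuple t)%R.
Proof.
rewrite /certificate_tuple /certificate.
(* The forms are arbitrary from here on; this also keeps the conversion checks
   below from unfolding them. *)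
move: (form1 E) (form2 E) (form3 E) (form4 E) (degree_gap E) (codegree_gap E).
move=> f1 f2 f3 f4 f5 f6.
rewrite !big_split /=.
have -> : (\sum_(t : 6.-tuple V) - 1536%Z = - (1536%Z * #|V|%:R ^+ 6) :> Z)%R.
  by rewrite sumrN sumr_const card_tuple -natrX mulr_natr.
have -> : (\sum_(t : 6.-tuple V) 3456%Z * (bit (E (entry t 0) (entry t 1) (entry t 2))
           + bit (E (entry t 0) (entry t 1) (entry t 3)))
         = 6912%Z * ordered_edges * #|V|%:R ^+ 3 :> Z)%R.
  rewrite -mulr_sumr (sum_tuple6 (fun x y u v _ _ => bit (E x y u) + bit (E x y v))%R).
  have -> : 6912%Z = (3456%Z * 2)%R by [].
  rewrite -!mulrA; congr (_ * _)%R.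
  rewrite mulrA /ordered_edges mulr_sumr mulr_suml; apply: eq_bigr => x _.
  rewrite mulr_sumr mulr_suml; apply: eq_bigr => y _.
  under eq_bigr => u _ do under eq_bigr => v _ do
    rewrite !sumr_const -mulrnA.
  transitivity (\sum_u \sum_v (bit (E x y u) + bit (E x y v)) * (#|V|%:R * #|V|%:R))%R.
    apply: eq_bigr => u _; apply: eq_bigr => v _; by rewrite -[LHS]mulr_natr natrM.
  under eq_bigr => u _ do rewrite -mulr_suml big_split /= sumr_const -[X in (X + _)%R]mulr_natr.
  rewrite -mulr_suml big_split /= -mulr_suml sumr_const -[X in (_ + X)%R]mulr_natr.
  have aux (R : comPzRingType) (s n : R) : ((s * n + s * n) * (n * n) = 2 * s * n ^+ 3)%R.
    by rewrite (_ : 2 = 1 + 1 :> R)%R ?mulrDl ?mul1r ?mulrDl ?exprS ?expr0 ?mulr1 ?mulrA.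
  exact: aux.
rewrite lerB // lerDr.
repeat apply: addr_ge0; try exact: sum_square_ge0.
apply: (@sum_codegree_gap_ge0 _ (fun x y u v => bit (E x y u) * bit (E x y v))%R f6) => //.
by move=> x y u v; do 2!case: (E _ _ _).
Qed.

End SumOfCertificate.

(** In a homomorphic image of [C5minus] only the vertices [b] and [e], which share
    no edge, can coincide; ruling this out leaves genuine copies. *)
Definition C5minus_inj_free T (E : ternary T) : Prop :=
  forall a b c d e, b <> e -> E a b c -> E b c d -> E c d e -> E d e a -> False.

Lemma certificate_bound : exists B : Z, forall T (H : ternary T) x y u v u' v',
  (certificate H x y u v u' v' <= B)%R.
Proof.
(* 396 * 200^2 for the four forms, 5724 + 4 * 20736 + 2 * 3456 for the rest. *)
exists 16000000%Z => T H x y u v u' v'; rewrite /certificate.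
have prod_le (p q M : Z) : (- M <= p <= M -> - M <= q <= M -> p * q <= M * M)%Z by nia.
have le1 w z : (-200 <= form1 H x y w z <= 200)%Z.
  by rewrite /form1 /pair_form; do 4!case: (H _ _ _).
have le2 w z : (-200 <= form2 H x y w z <= 200)%Z.
  by rewrite /form2 /pair_form; do 4!case: (H _ _ _).
have le3 w z : (-200 <= form3 H x y w z <= 200)%Z.
  by rewrite /form3 /pair_form; do 4!case: (H _ _ _).
have le4 w z : (-200 <= form4 H x y w z <= 200)%Z.
  by rewrite /form4 /pair_form; do 4!case: (H _ _ _).
have le5 w z : (-1 <= degree_gap H x y w z <= 1)%Z.
  by rewrite /degree_gap; do 2!case: (H _ _ _).
have le6 w : (-2 <= codegree_gap H x y u v w <= 2)%Z.
  by rewrite /codegree_gap; do 4!case: (H _ _ _).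
have := prod_le _ _ 200%Z (le1 u v) (le1 u' v'); have := prod_le _ _ 200%Z (le2 u v) (le2 u' v').
have := prod_le _ _ 200%Z (le3 u v) (le3 u' v'); have := prod_le _ _ 200%Z (le4 u v) (le4 u' v').
have := prod_le _ _ 1%Z (le5 u v) (le5 u' v'); have := prod_le _ _ 2%Z (le6 u') (le6 v').
move: (codegree_gap _ _ _ _ _ _) (codegree_gap _ _ _ _ _ _) => p6 q6.
move: (degree_gap _ _ _ _ _) (degree_gap _ _ _ _ _) => p5 q5.
move: (form4 _ _ _ _ _) (form4 _ _ _ _ _) (form3 _ _ _ _ _) (form3 _ _ _ _ _) => p4 q4 p3 q3.
move: (form2 _ _ _ _ _) (form2 _ _ _ _ _) (form1 _ _ _ _ _) (form1 _ _ _ _ _) => p2 q2 p1 q1.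
by do 2!case: (H _ _ _); rewrite /bit; lia.
Qed.

Lemma sum_const_seq (A : zmodType) (I : Type) (r : seq I) (x : A) :
  (\sum_(i <- r) x = x *+ size r)%R.
Proof. by elim: r => [|i r IHr]; rewrite ?big_nil // big_cons IHr mulrS. Qed.

Lemma of_natE n : Z.of_nat n = n%:R%R.
Proof. by elim: n => // n IHn; rewrite mulrS -IHn Nat2Z.inj_succ; lia. Qed.

Section Averaging.
Variables (V : finType) (E : ternary V).
Hypotheses (tsE : triple_system E) (c5E : C5minus_inj_free E) (f32E : F32_free E).

Definition K4minus_at (t : 6.-tuple V) (k : 'I_6 * 'I_6 * 'I_6 * 'I_6) : bool :=
  let: (a, b, c, d) := k in
  [&& E (tnth t a) (tnth t b) (tnth t c), E (tnth t a) (tnth t b) (tnth t d)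
    & E (tnth t a) (tnth t c) (tnth t d)].

Definition has_K4minus (t : 6.-tuple V) : bool := [exists k, K4minus_at t k].

Lemma entry_ord n (t : n.+1.-tuple V) i : exists j : 'I_n.+1, entry t i = tnth t j.
Proof.
have [i_n|n_i] := ltnP i n.+1; last first.
  by exists ord0; rewrite /entry nth_default ?size_tuple.
by exists (Ordinal i_n); rewrite (tnth_nth (thead t)).
Qed.

(** An image of [C5minus] in the tuple is either injective, excluded in [E], or
    identifies [b] and [e] and is then a [K4-] with apex [b]. *)
Lemma locally_free_entries t : ~~ has_K4minus t -> locally_free (pull (entry t) E).
Proof.
move=> noK4.
have ts : triple_system (pull (entry t) E) by apply: pull_triple_system.
have k4 : K4minus_free (pull (entry t) E).
  move=> a b c d abc abd acd; apply: (negP noK4); apply/existsP.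
  have [[a' ea] [b' eb]] := (entry_ord t a, entry_ord t b).
  have [[c' ec] [d' ed]] := (entry_ord t c, entry_ord t d).
  exists (a', b', c', d'); rewrite /K4minus_at -ea -eb -ec -ed.
  by apply/and3P; split.
split=> // [a b c d e abc bcd cde dea|a b c d e].
  have [ebe|nbe] := eqVneq (entry t b) (entry t e).
    have [s12 s23 _] := ts.
    have dba : pull (entry t) E d b a by move: dea; rewrite /pull -ebe.
    by apply: (k4 b a c d); [rewrite s12|rewrite s23 s12|].
  exact: (c5E (elimN eqP nbe) abc bcd cde dea).
exact: f32E.
Qed.

(** If two tuples differ only at the apex [a], their two apexes over the base
    [b c d] span the path of edges of a [C5minus]; so a tuple is determined by
    its other five entries. *)
Lemma card_K4minus_at k : #|[pred t | K4minus_at t k]| <= #|V| ^ 5.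
Proof.
case: k => [[[a b] c] d]; have [s12 s23 irr] := tsE.
rewrite -(card_tuple 5 V).
pose drop_a (t : 6.-tuple V) := [tuple tnth t (lift a j) | j < 5].
rewrite -(@card_in_image _ _ drop_a); first exact: max_card.
move=> t t'; rewrite !inE => /and3P[abc abd acd] /and3P[abc' abd' acd'] eq_drop.
have eq_off j : a != j -> tnth t j = tnth t' j.
  case/unlift_some => j' -> _.
  by have := congr1 (fun s => tnth s j') eq_drop; rewrite !tnth_mktuple.
have nab : a != b by apply: contraTneq abc => ->; rewrite irr.
have nac : a != c by apply: contraTneq abc => ->; rewrite s23 irr.
have nad : a != d by apply: contraTneq abd => ->; rewrite s23 irr.
rewrite -(eq_off c nac) -(eq_off d nad) in acd'; rewrite -(eq_off b nab) -(eq_off d nad) in abd'.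
apply: eq_from_tnth => j; have [<-|/eq_off//] := eqVneq a j.
have [//|/eqP neq] := eqVneq (tnth t a) (tnth t' a).
case: (c5E (a := tnth t b) (c := tnth t c) (d := tnth t d) neq) => //.
- by rewrite s12.
- by rewrite s23 s12.
- by rewrite s12 s23.
Qed.

Lemma card_has_K4minus : #|[pred t | has_K4minus t]| <= 1296 * #|V| ^ 5.
Proof.
have sub : #|[pred t | has_K4minus t]| <=
    \sum_(k : 'I_6 * 'I_6 * 'I_6 * 'I_6) #|[pred t | K4minus_at t k]|.
  rewrite -sum1_card; under [X in _ <= X]eq_bigr => k _ do rewrite -sum1_card big_mkcond.
  rewrite big_mkcond exchange_big /=; apply: leq_sum => t _.
  rewrite inE; case: ifP => // /existsP[k Kk].
  by rewrite (bigD1 k) //= inE Kk.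
apply: leq_trans sub _.
apply: (@leq_trans (\sum_(k : 'I_6 * 'I_6 * 'I_6 * 'I_6) #|V| ^ 5)).
  by apply: leq_sum => k _; apply: card_K4minus_at.
by rewrite sum_nat_const !card_prod !card_ord.
Qed.

(** Permuting the entries is a bijection on tuples, so each ordering contributes
    the same sum. *)
Lemma sum_sym_certificate :
  (\sum_(t : 6.-tuple V) sym_certificate (pull (entry t) E) =
   (\sum_(t : 6.-tuple V) certificate E (entry t 0) (entry t 1) (entry t 2)
      (entry t 3) (entry t 4) (entry t 5)) *+ size orderings6)%R.
Proof.
rewrite /sym_certificate exchange_big /=.
set A := (X in (_ = X *+ _)%R).
have permA s : s \in orderings6 ->
    (\sum_(t : 6.-tuple V) certificate_at (pull (entry t) E) s = A)%R.
  move=> /permutes_nth sP; rewrite /certificate_at /A.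
  pose act (t : 6.-tuple V) := [tuple entry t (nth 0 s i) | i < 6].
  have entry_act t i : i < 6 -> entry (act t) i = entry t (nth 0 s i).
    move=> i6; transitivity (tnth (act t) (Ordinal i6)); last by rewrite tnth_mktuple.
    by rewrite (tnth_nth (thead (act t))).
  have act_inj : injective act.
    move=> t t' eq_act; apply: eq_from_tnth => j.
    have /mapP[i] : val j \in [seq nth 0 s i | i <- iota 0 6].
      by rewrite (perm_mem sP) mem_iota ltn_ord.
    rewrite mem_iota /= => i6 ji.
    have entry_j (t0 : 6.-tuple V) : tnth t0 j = entry t0 (nth 0 s i).
      by rewrite (tnth_nth (thead t0)) /entry -ji.
    by rewrite !entry_j -!entry_act // eq_act.
  pose G (t : 6.-tuple V) := certificate E (entry t 0) (entry t 1) (entry t 2)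
    (entry t 3) (entry t 4) (entry t 5).
  transitivity (\sum_t G (act t))%R.
    by apply: eq_bigr => t _; rewrite certificate_pull /G !entry_act.
  by symmetry; apply: (reindex_inj act_inj).
by rewrite (eq_big_seq _ permA) sum_const_seq.
Qed.

End Averaging.

(** The sum of [sym_certificate] over tuples is nonpositive up to the O(n^5) tuples
    with a [K4-], each contributing a bounded amount; comparing with
    [sum_certificate_ge] and dividing by 768 n^3 gives the bound. *)
Lemma ordered_edges_le : exists C : nat, forall (V : finType) (E : ternary V),
  triple_system E -> C5minus_inj_free E -> F32_free E ->
  9 * #|[pred t : V * V * V | E t.1.1 t.1.2 t.2]| <= 2 * #|V| ^ 3 + C * #|V| ^ 2.
Proof.
have [b cert_le] : exists b : nat, forall T (H : ternary T) x y u v u' v',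
    (certificate H x y u v u' v' <= b%:R)%R.
  have [B cert_le] := certificate_bound; exists (Z.to_nat B) => T H x y u v u' v'.
  by have := cert_le T H x y u v u' v'; rewrite -of_natE; lia.
exists (1296 * b) => V E ts c5 f32.
have [V0|V_gt0] := posnP #|V|.
  by rewrite eq_card0 ?muln0 // => -[[x y] z]; have := fintype0 x V0.
have sumE : (\sum_(t : V * V * V) bit (E t.1.1 t.1.2 t.2) = ordered_edges E)%R.
  by rewrite /ordered_edges pair_bigA /= pair_bigA.
set S := #|_|; have {sumE}S_E : (S%:R = ordered_edges E :> Z)%R.
  rewrite -sumE /S -sum1_card natr_sum big_mkcond /=; apply: eq_bigr => t _.
  by rewrite inE; case: ifP.
have le_sym (t : 6.-tuple V) :
    (sym_certificate (pull (entry t) E) <=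
     (if has_K4minus E t then b%:R *+ size orderings6 else 0))%R.
  case: ifPn => [_|noK4]; last exact/sym_certificate_le0/locally_free_entries.
  rewrite /sym_certificate.
  apply: (@le_trans _ _ (\sum_(s <- orderings6) b%:R)%R).
    by apply: ler_sum => s _; apply: cert_le.
  by rewrite sum_const_seq.
have : (\sum_(t : 6.-tuple V) sym_certificate (pull (entry t) E) <=
        \sum_(t : 6.-tuple V) (if has_K4minus E t then b%:R *+ size orderings6 else 0))%R.
  by apply: ler_sum => t _; apply: le_sym.
rewrite sum_sym_certificate // -big_mkcond /= sumr_const -mulrnA mulnC mulrnA.
rewrite lerMn2r /= => upper; have {upper} := le_trans (sum_certificate_ge E) upper.
rewrite -S_E; set N := #|V|; set K := #|_|.
have K_le : K <= 1296 * N ^ 5 by apply: card_has_K4minus.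
rewrite (_ : 6912%Z = 768%Z * 9%:R :> Z)%R // (_ : 1536%Z = 768%Z * 2%:R :> Z)%R //.
rewrite -!mulrA -mulrBr -!natrX -!natrM -mulrnA => le768.
have {le768} : ((9 * (S * N ^ 3))%:R - (2 * N ^ 6)%:R <= (b * K)%:R :> Z)%R.
  rewrite -(ler_pM2l (_ : 0 < 768%Z :> Z)%R) //; apply: le_trans le768 _.
  rewrite -[X in (X <= _)%R]mul1r; exact: ler_wpM2r.
rewrite lerBlDr -natrD ler_nat => le_n.
rewrite -(@leq_pmul2r (N ^ 3)) ?expn_gt0 ?V_gt0 // mulnDl -(mulnA 9) -(mulnA 2).
rewrite -(mulnA (1296 * b)) -(mulnA 1296 b) -!expnD.
apply: leq_trans le_n _; rewrite addnC leq_add2l mulnCA leq_mul2l.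
by rewrite K_le orbT.
Qed.

(** * Monotonicity and limit of the density *)

Lemma delete_vertex_card3 (H : graph3) (v : vertex H) (e : {set {x : vertex H | x != v}}) :
  e \in [set e : {set {x : vertex H | x != v}} | val @: e \in edges H] -> #|e| = 3.
Proof. by rewrite inE => /edges_card3; rewrite card_imset //; apply: val_inj. Qed.

Definition delete_vertex (H : graph3) (v : vertex H) : graph3 :=
  Graph3 (@delete_vertex_card3 H v).

Lemma family_free_delete_vertex FF (H : graph3) (v : vertex H) :
  family_free FF H -> family_free FF (delete_vertex v).
Proof.
move=> freeH F FF_F [f [f_inj f_edges]]; apply: (freeH F FF_F).
exists (fun x => val (f x)); split; first by move=> x y /val_inj/f_inj.
by move=> e /f_edges; rewrite inE -imset_comp.
Qed.

Lemma card_delete_vertex (H : graph3) (v : vertex H) :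
  #|vertex (delete_vertex v)| = #|vertex H|.-1.
Proof. by rewrite card_sig -(cardC1 v); apply: eq_card => x; rewrite !inE. Qed.

Lemma edges_delete_vertex (H : graph3) (v : vertex H) :
  #|edges (delete_vertex v)| = #|[set e in edges H | v \notin e]|.
Proof.
rewrite -(card_imset _ (imset_inj val_inj)); apply: eq_card => e.
rewrite inE; apply/imsetP/andP => [[e' e'_in ->]|[e_in ve]].
  rewrite inE in e'_in; split=> //; apply/imsetP => -[x _ vx].
  by have := valP x; rewrite -vx eqxx.
have eE : e = val @: [set x : {x | x != v} | val x \in e].
  apply/setP => x; apply/idP/imsetP => [xe|[y]]; last by rewrite inE => ye ->.
  have xv : x != v by apply: contraNneq ve => <-.
  by exists (Sub x xv); rewrite ?inE SubK.
by exists [set x : {x | x != v} | val x \in e]; rewrite // inE -eE.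
Qed.

Lemma sum_edges_delete_vertex (H : graph3) :
  \sum_v #|edges (@delete_vertex H v)| = (#|vertex H| - 3) * #|edges H|.
Proof.
under eq_bigr => v _ do rewrite edges_delete_vertex -sum1_card big_mkcond.
rewrite exchange_big /= (bigID (mem (edges H))) /= [X in _ + X]big1 ?addn0; last first.
  by move=> e eN; rewrite big1 // => v _; rewrite inE (negPf eN).
transitivity (\sum_(e in edges H) (#|vertex H| - 3)).
  apply: eq_bigr => e eH; rewrite -(edges_card3 eH).
  have -> : (#|vertex H| - #|e|)%N = #|finset.setC e| by rewrite [RHS]cardsCs finset.setCK.
  rewrite -sum1_card [RHS]big_mkcond.
  by apply: eq_bigr => v _; rewrite !inE eH.
by rewrite sum_nat_const mulnC.
Qed.

Lemma edges_le_bin (H : graph3) : #|edges H| <= 'C(#|vertex H|, 3).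
Proof.
rewrite -card_draws; apply/subset_leq_card/fintype.subsetP => e /edges_card3 e3.
by rewrite inE e3.
Qed.

Lemma edges_le_turan_number FF (H : graph3) :
  family_free FF H -> #|edges H| <= turan_number #|vertex H| FF.
Proof.
move=> freeH; have lt : #|edges H| < 'C(#|vertex H|, 3).+1 by rewrite ltnS edges_le_bin.
by apply: (@leq_bigmax_cond _ _ _ (Ordinal lt)); apply/asboolP; exists H.
Qed.

Lemma turan_number_attained n FF : turan_number n FF = 0 \/
  exists H : graph3, [/\ #|vertex H| = n, #|edges H| = turan_number n FF & family_free FF H].
Proof.
rewrite /turan_number.
apply: (big_ind (fun k => k = 0 \/ exists H : graph3,
    [/\ #|vertex H| = n, #|edges H| = k & family_free FF H])); first by left.
  by move=> k l k_ok l_ok; case/orP: (leq_total k l) => [/maxn_idPr|/maxn_idPl] ->.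
by move=> k /asboolP; right.
Qed.

(** Each edge survives in all but three of the vertex-deleted subgraphs. *)
Lemma turan_number_step n FF :
  (n - 2) * turan_number n.+1 FF <= n.+1 * turan_number n FF.
Proof.
have [->|[H [Hn <- freeH]]] := turan_number_attained n.+1 FF; first by rewrite muln0.
have -> : n - 2 = #|vertex H| - 3 by rewrite Hn; lia.
rewrite -sum_edges_delete_vertex -{1}Hn -sum_nat_const; apply: leq_sum => v _.
have -> : n = #|vertex (delete_vertex v)| by rewrite card_delete_vertex Hn.
exact/edges_le_turan_number/family_free_delete_vertex.
Qed.

Section Density.

Local Open Scope ring_scope.

Variables (R : realType) (FF : Defs.family).

Definition density_at (n : nat) : R := (turan_number n FF)%:R / 'C(n, 3)%:R.

Lemma density_at_step n : (2 < n)%N -> density_at n.+1 <= density_at n.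
Proof.
move=> n3; have bin_gt0' m : (2 < m)%N -> 0 < ('C(m, 3))%:R :> R.
  by move=> m3; rewrite ltr0n bin_gt0.
rewrite /density_at ler_pdivrMr; last by apply: bin_gt0'; lia.
rewrite mulrAC ler_pdivlMr; last exact: bin_gt0'.
rewrite -!natrM ler_nat.
have binS : ((n - 2) * 'C(n.+1, 3) = n.+1 * 'C(n, 3))%N.
  by have := mul_bin_down n.+1 3; rewrite subSS => <-.
have n2 : (0 < n - 2)%N by lia.
rewrite -(leq_pmul2l n2) mulnA [leqRHS]mulnCA binS [leqRHS]mulnCA [leqRHS]mulnA.
by rewrite leq_mul2r turan_number_step orbT.
Qed.

Lemma density_at_ge0 n : 0 <= density_at n.
Proof. by rewrite divr_ge0. Qed.

Let shifted n := density_at (n + 3).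

Let shifted_nonincreasing : nonincreasing_seq shifted.
Proof. by apply/nonincreasing_seqP => n; rewrite /shifted addSn density_at_step //; lia. Qed.

Let shifted_cvg : cvgn shifted.
Proof.
apply: nonincreasing_is_cvgn shifted_nonincreasing _.
by exists 0 => _ [n _ <-]; apply: density_at_ge0.
Qed.

Let lim_shifted : turan_density R FF = limn shifted.
Proof. by apply/cvg_lim => //; rewrite -(cvg_shiftn 3); apply: shifted_cvg. Qed.

Lemma turan_density_le n : (2 < n)%N -> turan_density R FF <= density_at n.
Proof.
move=> n3; rewrite lim_shifted -(subnK n3).
exact: nonincreasing_cvgn_ge shifted_nonincreasing shifted_cvg _.
Qed.

(** By monotonicity a bound on infinitely many terms is a bound on all of them. *)
Lemma turan_density_ge (c : R) :
  (forall m, exists2 n, (m <= n)%N & c <= density_at n) -> c <= turan_density R FF.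
Proof.
move=> freq; rewrite lim_shifted; apply: limr_ge => //; apply: nearW => m.
have [n mn c_n] := freq (m + 3)%N; apply: le_trans c_n _.
rewrite -(@subnK 3 n); last lia.
by apply: shifted_nonincreasing; lia.
Qed.

End Density.

(** * Copies of the forbidden graphs *)

Definition edge_rel (G : graph3) : ternary (vertex G) :=
  fun x y z => [set x; y; z] \in edges G.

Lemma set3C12 (T : finType) (x y z : T) : [set x; y; z] = [set y; x; z].
Proof. by rewrite (finset.setUC [set x]). Qed.

Lemma set3C23 (T : finType) (x y z : T) : [set x; y; z] = [set x; z; y].
Proof. by rewrite finset.setUAC. Qed.

Lemma card3_uniq (T : finType) (x y z : T) : #|[set x; y; z]| = 3 -> uniq [:: x; y; z].
Proof.
rewrite finset.setUC cardsU1 cards2 !inE /= !inE !negb_or (eq_sym z x) (eq_sym z y).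
by case: (x == y); case: (x == z); case: (y == z).
Qed.

Lemma edge_rel_triple_system (G : graph3) : triple_system (@edge_rel G).
Proof.
split=> [x y z|x y z|x y]; first by rewrite /edge_rel set3C12.
  by rewrite /edge_rel set3C23.
apply/negP => /edges_card3; rewrite finset.setUid => card3.
by have := cards2 x y; rewrite card3; case: (x != y).
Qed.

Lemma edge_vertices_neq T (H : ternary T) (x y z : T) : triple_system H ->
  H x y z -> [/\ x <> y, x <> z & y <> z].
Proof.
move=> [s12 s23 irr] Hxyz; split=> eq; move: Hxyz; rewrite eq.
- by rewrite irr.
- by rewrite s23 irr.
- by rewrite s12 s23 irr.
Qed.

Lemma imset3 (S T : finType) (f : S -> T) x y z :
  f @: [set x; y; z] = [set f x; f y; f z].
Proof. by rewrite !imsetU !imset_set1. Qed.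

Lemma nth_inj (T : eqType) (x0 : T) (s : seq T) : uniq s ->
  injective (fun i : 'I_(size s) => nth x0 s i).
Proof. by move=> us i j /eqP; rewrite nth_uniq // => /eqP/val_inj. Qed.

Lemma contains_F32 (G : graph3) : contains G F32 -> ~ F32_free (@edge_rel G).
Proof.
move=> [f [_ f_edges]] free.
apply: (free (f (inord 0)) (f (inord 1)) (f (inord 2)) (f (inord 3)) (f (inord 4)));
  rewrite /edge_rel -imset3; apply: f_edges; rewrite !inE eqxx ?orbT //.
Qed.

(** Every two of [a b c d e] lie in one of the four edges, hence are distinct. *)
Lemma F32_free_edge_rel (G : graph3) : ~ contains G F32 -> F32_free (@edge_rel G).
Proof.
move=> noF a b c d e abc ade bde cde; apply: noF.
have ts := edge_rel_triple_system G.
have [/eqP nab /eqP nac /eqP nbc] := edge_vertices_neq ts abc.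
have [/eqP nad /eqP nae /eqP nde] := edge_vertices_neq ts ade.
have [/eqP nbd /eqP nbe _] := edge_vertices_neq ts bde.
have [/eqP ncd /eqP nce _] := edge_vertices_neq ts cde.
have us : uniq [:: a; b; c; d; e].
  by rewrite /= !inE !negb_or nab nac nad nae nbc nbd nbe ncd nce nde.
exists (fun i : 'I_5 => nth a [:: a; b; c; d; e] i); split.
  exact: nth_inj us.
by move=> E; rewrite !inE -!orbA => /or4P[] /eqP->; rewrite imset3 !inordK.
Qed.

Lemma ordS_inord n i : i < n.+1 -> ordS (inord i : 'I_n.+1) = inord (i.+1 %% n.+1).
Proof. by move=> i_n; apply: val_inj; rewrite /= !inordK // ltn_mod. Qed.

Lemma mem_C5minus_edges (e : {set 'I_5}) : (e \in edges C5minus) =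
  [|| e == triple5 1 2 3, e == triple5 2 3 4, e == triple5 3 4 5 | e == triple5 4 5 1].
Proof.
apply/idP/idP => [/setD1P[ne /imsetP[i _ eE]]|].
  move: ne; rewrite {}eE -(inord_val i) !ordS_inord //; last by rewrite ltn_mod.
  by case: i => [[|[|[|[|[|]]]]]] //= _; rewrite /triple5 /= ?eqxx ?orbT.
have mem i : i < 5 ->
    [set inord i; inord (i.+1 %% 5); inord (i.+2 %% 5)] \in tight_cycle_edges 5.
  move=> i5; apply/imsetP; exists (inord i) => //.
  have mod2 : ((i.+1 %% 5).+1 %% 5 = i.+2 %% 5)%N by rewrite -addn1 modnDml addn1.
  by rewrite !ordS_inord ?ltn_mod // mod2.
have neq i j k l m n : [&& i < 5, j < 5, k < 5, l < 5, m < 5 & n < 5] ->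
    ~~ [&& i \in [:: l; m; n], j \in [:: l; m; n] & k \in [:: l; m; n]] ->
    [set inord i; inord j; inord k] != [set inord l; inord m; inord n] :> {set 'I_5}.
  move=> lt; apply: contraNneq => eqS.
  have : [set inord i; inord j; inord k : 'I_5] \subset [set inord l; inord m; inord n].
    by rewrite eqS.
  have inj x y : x < 5 -> y < 5 -> (inord x == inord y :> 'I_5) = (x == y).
    by move=> x5 y5; rewrite -val_eqE /= !inordK.
  case/and5P: lt => i5 j5 k5 l5 /andP[m5 n5].
  by rewrite !finset.subUset !finset.sub1set !inE !inj // -!orbA andbA.
by case/or4P => /eqP ->; apply/setD1P; split; rewrite ?neq //; apply: mem.
Qed.

Lemma contains_C5minus (G : graph3) : contains G C5minus -> ~ C5minus_free (@edge_rel G).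
Proof.
move=> [f [_ f_edges]] free.
apply: (free (f (inord 0)) (f (inord 1)) (f (inord 2)) (f (inord 3)) (f (inord 4)));
  rewrite /edge_rel -imset3; apply: f_edges; rewrite mem_C5minus_edges !eqxx ?orbT //.
Qed.

Lemma C5minus_inj_free_edge_rel (G : graph3) :
  ~ contains G C5minus -> C5minus_inj_free (@edge_rel G).
Proof.
move=> noC a b c d e nbe abc bcd cde dea; apply: noC.
have ts := edge_rel_triple_system G.
have [/eqP nab /eqP nac /eqP nbc] := edge_vertices_neq ts abc.
have [_ /eqP nbd /eqP ncd] := edge_vertices_neq ts bcd.
have [_ /eqP nce /eqP nde] := edge_vertices_neq ts cde.
have [_ /eqP nda /eqP nea] := edge_vertices_neq ts dea.
move/eqP in nbe.
have us : uniq [:: a; b; c; d; e].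
  by rewrite /= !inE !negb_or nab nac (eq_sym a) nda (eq_sym a) nea nbc nbd nbe ncd nce nde.
exists (fun i : 'I_5 => nth a [:: a; b; c; d; e] i); split.
  exact: nth_inj us.
by move=> E; rewrite mem_C5minus_edges => /or4P[] /eqP->; rewrite imset3 !inordK.
Qed.

(** * Blow-ups *)

Lemma eq_set3 (T : finType) (e : {set T}) (x y z : T) : #|e| = 3 ->
  ([set x; y; z] == e) = all (mem e) [:: x; y; z] && uniq [:: x; y; z].
Proof.
move=> e3; apply/eqP/andP => [eE|[sub us]].
  rewrite -eE in e3 *; split; last exact: card3_uniq.
  by rewrite /= !inE !eqxx ?orbT.
apply/eqP; rewrite eqEcard e3 (cards3 us) leqnn andbT.
by move: sub; rewrite /= andbT !finset.subUset !finset.sub1set andbA.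
Qed.

(** An edge has 3 * 2 * 1 orderings, counted as duplicate-free 3-tuples. *)
Lemma card_ordered_edges (G : graph3) :
  #|[pred t : vertex G * vertex G * vertex G | edge_rel t.1.1 t.1.2 t.2]| = 6 * #|edges G|.
Proof.
set V := vertex G.
pose tup (t : V * V * V) := [tuple t.1.1; t.1.2; t.2].
have tup_inj : injective tup.
  by move=> [[x y] z] [[x' y'] z'] /(congr1 val) /= [-> -> ->].
have -> : #|[pred t : V * V * V | edge_rel t.1.1 t.1.2 t.2]| =
    \sum_(e in edges G) \sum_(t : V * V * V) ([set t.1.1; t.1.2; t.2] == e).
  rewrite exchange_big -sum1_card big_mkcond /=; apply: eq_bigr => -[[x y] z] _ /=.
  rewrite inE /= /edge_rel; case: ifPn => [xyz|nxyz].
    rewrite (bigD1 [set x; y; z]) //= eqxx big1 // => e /andP[_ /negPf].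
    by rewrite eq_sym => ->.
  by rewrite big1 // => e eG; case: eqP => // eE; rewrite eE eG in nxyz.
rewrite mulnC -sum_nat_const; apply: eq_bigr => e eG.
have e3 := edges_card3 eG.
transitivity #|[set t : 3.-tuple V | all (mem e) t & uniq t]|; last first.
  by rewrite card_uniq_tuples -[#|_|]/(#|e|) e3.
rewrite -big_mkcond /= sum1dep_card -(card_imset _ tup_inj); apply: eq_card => t; rewrite inE.
apply/imsetP/idP => [[[[x y] z]]|].
  by rewrite !inE /= eq_set3 // => ? ->.
case/tupleP: t => x t; case/tupleP: t => y t; case/tupleP: t => z t.
rewrite tuple0 => xyz; exists (x, y, z); last exact: val_inj.
by rewrite !inE /= eq_set3.
Qed.

Section GraphOf.
Variables (U : finType) (H : ternary U).
Hypothesis ts : triple_system H.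

Definition graph_of_edges : {set {set U}} :=
  [set [set t.1.1; t.1.2; t.2] | t : U * U * U & H t.1.1 t.1.2 t.2].

Lemma graph_of_card3 e : e \in graph_of_edges -> #|e| = 3.
Proof.
case/imsetP=> -[[x y] z]; rewrite inE /= => Hxyz ->; apply: cards3.
have [/eqP xy /eqP xz /eqP yz] := edge_vertices_neq ts Hxyz.
by rewrite /= !inE negb_or xy xz yz.
Qed.

Definition graph_of : graph3 := Graph3 graph_of_card3.

Lemma edge_rel_graph_of : @edge_rel graph_of = H.
Proof.
apply/funext => x; apply/funext => y; apply/funext => z.
apply/idP/idP => [xyz|Hxyz]; last by apply/imsetP; exists (x, y, z); rewrite ?inE.
have := edges_card3 xyz; move: xyz => /imsetP[[[a b] c]]; rewrite inE /= => Habc eq3 card3.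
have := eq_set3 a b c card3; rewrite -eq3 eqxx => /esym/andP[_ uabc].
have cabc : #|[set a; b; c]| = 3 by rewrite -eq3.
have := eq_set3 x y z cabc; rewrite eq3 eqxx => /esym/andP[].
move: ts => [s12 s23 irr]; rewrite /= !inE !andbT !negb_or -!orbA.
by move=> /and3P[/or3P[]/eqP-> /or3P[]/eqP-> /or3P[]/eqP->]; rewrite ?eqxx ?andbF //= => _;
  first [by rewrite s12|by rewrite s23|by rewrite s12 s23
        |by rewrite s23 s12|by rewrite s12 s23 s12].
Qed.

End GraphOf.

Definition blow_up (k m : nat) (H : ternary nat) (ts : triple_system H) : graph3 :=
  graph_of (pull_triple_system (fun u : 'I_k * 'I_m => val u.1) ts).

Lemma sum_ord_iota k (F : nat -> nat) : \sum_(i < k) F i = sumn [seq F i | i <- iota 0 k].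
Proof. by rewrite -(big_mkord xpredT F) sumnE big_map /index_iota subn0. Qed.

Definition count_triples k (H : ternary nat) : nat :=
  sumn [seq sumn [seq sumn [seq H a b c : nat | c <- iota 0 k] | b <- iota 0 k] | a <- iota 0 k].

Lemma edges_blow_up k m H (ts : triple_system H) :
  6 * #|edges (blow_up k m ts)| = m ^ 3 * count_triples k H.
Proof.
rewrite -card_ordered_edges edge_rel_graph_of -sum1_card big_mkcond /=.
have sum_fst (F : nat -> nat) :
    \sum_(u : 'I_k * 'I_m) F u.1 = m * sumn [seq F i | i <- iota 0 k].
  rewrite -(pair_bigA _ (fun (i : 'I_k) (_ : 'I_m) => F i)) /= -sum_ord_iota big_distrr /=.
  by apply: eq_bigr => i _; rewrite sum_nat_const card_ord.
pose U := ('I_k * 'I_m)%type.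
transitivity (\sum_(x : U) \sum_(y : U) \sum_(z : U) (H x.1 y.1 z.1 : nat)).
  rewrite pair_bigA /= pair_bigA /=; apply: eq_bigr => -[[x y] z] _ /=.
  by rewrite inE /= /pull; case: (H _ _ _).
transitivity (\sum_(x : U) \sum_(y : U)
    m * sumn [seq H x.1 y.1 c : nat | c <- iota 0 k]).
  by apply: eq_bigr => x _; apply: eq_bigr => y _; rewrite (sum_fst (H x.1 y.1)).
transitivity (\sum_(x : U)
    m * (m * sumn [seq sumn [seq H x.1 b c : nat | c <- iota 0 k] | b <- iota 0 k])).
  apply: eq_bigr => x _; rewrite -big_distrr /=.
  by rewrite (sum_fst (fun b => sumn [seq H x.1 b c : nat | c <- iota 0 k])).
rewrite -!big_distrr /= (sum_fst (fun a =>
  sumn [seq sumn [seq H a b c : nat | c <- iota 0 k] | b <- iota 0 k])).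
by rewrite !expnS expn0 muln1 !mulnA.
Qed.

Lemma card_blow_up k m H (ts : triple_system H) : #|vertex (blow_up k m ts)| = k * m.
Proof. by rewrite card_prod !card_ord. Qed.

Lemma blow_up_F32_free k m H (ts : triple_system H) :
  F32_free H -> ~ contains (blow_up k m ts) F32.
Proof.
by move=> f32 /contains_F32; apply; rewrite edge_rel_graph_of => a b c d e; apply: f32.
Qed.

Lemma blow_up_C5minus_free k m H (ts : triple_system H) :
  C5minus_free H -> ~ contains (blow_up k m ts) C5minus.
Proof.
by move=> c5 /contains_C5minus; apply; rewrite edge_rel_graph_of => a b c d e; apply: c5.
Qed.

Lemma adj_triple_system (g : seq (nat * nat * nat)) :
  all (fun t => t.1.1 < t.1.2 < t.2) g -> triple_system (adj g).
Proof.
move=> /allP increasing.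
have sort12 a b c : sort3 a b c = sort3 b a c.
  by rewrite /sort3; do ![case: leqP => ?]; try (congr (_, _, _)); lia.
have sort23 a b c : sort3 a b c = sort3 a c b.
  by rewrite /sort3; do ![case: leqP => ?]; try (congr (_, _, _)); lia.
split=> [a b c|a b c|a b]; first by rewrite /adj sort12.
  by rewrite /adj sort23.
apply/negP => /increasing; rewrite /sort3 leqnn.
by case: ifP => ba; rewrite /= ?ba /= ltnn ?andbF.
Qed.

Lemma adj_lt k (g : seq (nat * nat * nat)) a b c :
  all (fun t => t.2 < k) g -> all (fun t => t.1.1 < t.1.2 < t.2) g ->
  adj g a b c -> [&& a < k, b < k & c < k].
Proof.
move=> /allP small /allP incr abc; move: (small _ abc) (incr _ abc).
by rewrite /sort3; case: (a <= b) => /=; case: ifP => ? /=; try case: ifP => ? /=; lia.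
Qed.

(** The test only ranges over indices below [k], outside which [H] has no edges. *)
Lemma F32_free_of_check k (H : ternary nat) :
  (forall a b c, H a b c -> [&& a < k, b < k & c < k]) ->
  independent_neighborhoods k H -> F32_free H.
Proof.
move=> small /allP check a b c d e abc ade bde cde.
have /and3P[ak bk ck] := small _ _ _ abc; have /and3P[_ dk ek] := small _ _ _ ade.
have inI x : x < k -> x \in iota 0 k by rewrite mem_iota.
have /allP/(_ _ (inI _ ek))/allP/(_ a) := check _ (inI _ dk).
rewrite mem_filter ade inI // => /(_ isT)/allP/(_ b).
rewrite mem_filter bde inI // => /(_ isT)/nilp_filterP/(_ c).
by rewrite mem_filter cde inI //; apply.
Qed.

Lemma C5minus_free_of_check k (H : ternary nat) :
  (forall a b c, H a b c -> [&& a < k, b < k & c < k]) ->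
  pentagon_free k H -> C5minus_free H.
Proof.
move=> small /allP check a b c d e abc bcd cde dea.
have /and3P[ak bk ck] := small _ _ _ abc; have /and3P[_ dk ek] := small _ _ _ cde.
have inI x : x < k -> x \in iota 0 k by rewrite mem_iota.
have /allP/(_ _ (inI _ bk))/allP/(_ c) := check _ (inI _ ak).
rewrite mem_filter abc inI // => /(_ isT)/allP/(_ d).
rewrite mem_filter bcd inI // => /(_ isT)/nilp_filterP/(_ e (inI _ ek)).
by rewrite cde dea; apply.
Qed.

(** * The densities *)

Lemma edges_free_le : exists C : nat, forall G : graph3,
  family_free (family2 F32 C5minus) G ->
  54 * #|edges G| <= 2 * #|vertex G| ^ 3 + C * #|vertex G| ^ 2.
Proof.
have [C le_C] := ordered_edges_le; exists C => G freeG.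
have := le_C _ _ (edge_rel_triple_system G)
  (C5minus_inj_free_edge_rel (freeG C5minus (or_intror erefl)))
  (F32_free_edge_rel (freeG F32 (or_introl erefl))).
by rewrite card_ordered_edges mulnA.
Qed.

Definition F32_pattern : seq (nat * nat * nat) := [:: (0,1,2); (0,3,4); (1,3,4); (2,3,4)].

(** Nine points mapped to the five of [F32] with multiplicities 1, 1, 1, 3, 3: with
    equal weights the blow-ups would only reach density 24/125 < 2/9. *)
Definition F32_weighted : ternary nat :=
  pull (nth 5 [:: 0; 1; 2; 3; 3; 3; 4; 4; 4]) (adj F32_pattern).

Definition edge_pattern : ternary nat := adj [:: (0,1,2)].

Definition K4minus_pattern : ternary nat := adj [:: (0,1,2); (0,1,3); (0,2,3)].

Lemma edge_pattern_ts : triple_system edge_pattern.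
Proof. exact: adj_triple_system. Qed.

Lemma K4minus_pattern_ts : triple_system K4minus_pattern.
Proof. exact: adj_triple_system. Qed.

Lemma F32_weighted_ts : triple_system F32_weighted.
Proof. by apply: pull_triple_system; apply: adj_triple_system. Qed.

Lemma edge_pattern_F32_free : F32_free edge_pattern.
Proof.
apply: (@F32_free_of_check 3); last by vm_compute.
by move=> a b c; apply: adj_lt.
Qed.

Lemma edge_pattern_C5minus_free : C5minus_free edge_pattern.
Proof.
apply: (@C5minus_free_of_check 3); last by vm_compute.
by move=> a b c; apply: adj_lt.
Qed.

Lemma K4minus_pattern_F32_free : F32_free K4minus_pattern.
Proof.
apply: (@F32_free_of_check 4); last by vm_compute.
by move=> a b c; apply: adj_lt.
Qed.

Lemma F32_weighted_C5minus_free : C5minus_free F32_weighted.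
Proof.
have : C5minus_free (adj F32_pattern).
  apply: (@C5minus_free_of_check 5); last by vm_compute.
  by move=> a b c; apply: adj_lt.
by move=> c5 a b c d e; apply: c5.
Qed.

Local Open Scope ring_scope.

Lemma bin3_mul6 n : (6 * 'C(n, 3) = n * n.-1 * n.-2)%N.
Proof. by rewrite mulnC (bin_ffact n 3) !ffactnS ffactn0 muln1 mulnA. Qed.

(** Ordered edges over n^3 bound the density from below because
    6 C(n,3) <= n^3. *)
Lemma density_at_ge (R : realType) FF (G : graph3) (c : R) : family_free FF G ->
  (2 < #|vertex G|)%N -> 0 <= c -> c * #|vertex G|%:R ^+ 3 <= 6 * #|edges G|%:R ->
  c <= density_at R FF #|vertex G|.
Proof.
set n := #|vertex G| => freeG n3 c0 le_c.
have bin_pos : 0 < 'C(n, 3)%:R :> R by rewrite ltr0n bin_gt0.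
rewrite /density_at ler_pdivlMr //; apply: (@le_trans _ _ #|edges G|%:R); last first.
  by rewrite ler_nat edges_le_turan_number.
rewrite -(ler_pM2l (_ : 0 < 6 :> R)) //; apply: le_trans le_c.
rewrite mulrCA -natrM bin3_mul6; apply: ler_wpM2l => //.
rewrite -natrX ler_nat !expnS expn0 muln1 mulnA.
by apply: leq_mul => //; first apply: leq_mul; lia.
Qed.

Lemma turan_density_blow_up (R : realType) FF k H (ts : triple_system H) : (0 < k)%N ->
  (forall m, family_free FF (blow_up k m ts)) ->
  (count_triples k H)%:R / k%:R ^+ 3 <= turan_density R FF.
Proof.
move=> k_gt0 freeB; apply: turan_density_ge => m; pose G := blow_up k (m + 3) ts.
have cardG : #|vertex G| = (k * (m + 3))%N by apply: card_blow_up.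
have big_n : (m + 3 <= k * (m + 3))%N by rewrite leq_pmull.
exists #|vertex G|; first by rewrite cardG; lia.
apply: density_at_ge; [exact: freeB|by rewrite cardG; lia|by rewrite divr_ge0 ?exprn_ge0|].
rewrite cardG natrM exprMn -mulrA mulKf; last by rewrite expf_neq0 // pnatr_eq0 -lt0n.
by rewrite -natrM edges_blow_up natrM natrX mulrC.
Qed.

(** If the density were 2/9 + eps, then for every n the number
    (2/9 + eps) n (n-1) (n-2) would be at most 2 n^3/9 + O(n^2), so that eps n
    would stay bounded. *)
Lemma turan_density_family2_le (R : realType) :
  turan_density R (family2 F32 C5minus) <= 2 / 9.
Proof.
have [C le_C] := edges_free_le; set L := turan_density _ _.
rewrite leNgt; apply/negP => ltL; pose eps := L - 2 / 9.
have eps0 : 0 < eps by rewrite subr_gt0.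
have ub n : (2 < n)%N -> eps * n%:R <= 3 * L + C%:R / 9.
  move=> n3; have leL := turan_density_le R (family2 F32 C5minus) n3.
  have bin_pos : 0 < 'C(n, 3)%:R :> R by rewrite ltr0n bin_gt0.
  move: leL; rewrite -/L /density_at ler_pdivlMr // => leL.
  have ex_le : (54 * turan_number n (family2 F32 C5minus) <= 2 * n ^ 3 + C * n ^ 2)%N.
    have [->|[G [<- <- freeG]]] := turan_number_attained n (family2 F32 C5minus).
      by rewrite muln0.
    exact: le_C.
  have {ex_le} : 54 * (turan_number n (family2 F32 C5minus))%:R
      <= 2 * n%:R ^+ 3 + C%:R * n%:R ^+ 2 :> R.
    by rewrite -!natrX -!natrM -natrD ler_nat.
  have : 6 * 'C(n, 3)%:R = n%:R * (n%:R - 1) * (n%:R - 2) :> R.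
    have -> : n%:R - 2 = n.-2%:R :> R by rewrite -subn2 natrB //; lia.
    have -> : n%:R - 1 = n.-1%:R :> R by rewrite -subn1 natrB //; lia.
    by rewrite -!natrM bin3_mul6.
  move: leL; set b := 'C(n, 3)%:R; set t := (turan_number _ _)%:R; set x := n%:R => leL b6 t54.
  have x0 : 0 < x by rewrite ltr0n; lia.
  have L0 : 0 < L by apply: lt_trans ltL; lra.
  rewrite -(ler_pM2r (_ : 0 < x ^+ 2)) ?exprn_gt0 // /eps.
  have : 9 * (L * (6 * b)) <= 2 * x ^+ 3 + C%:R * x ^+ 2 by lra.
  rewrite b6; nra.
have [N ltN] : exists N : nat, (3 * L + C%:R / 9) / eps < N%:R.
  by exists (Num.truncn ((3 * L + C%:R / 9) / eps)).+1; apply: truncnS_gt.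
have := ub (N + 3)%N; rewrite addn3 => /(_ isT); rewrite leNgt => /negP; apply.
rewrite -ltr_pdivrMl // mulrC; apply: lt_le_trans ltN _; rewrite ler_nat; lia.
Qed.

Theorem theorem5p2 (R : realType) :
  (turan_density R (family2 F32 C5minus) = 2 / 9 /\
   2 / 9 < Num.min (turan_density R (family1 F32))
                   (turan_density R (family1 C5minus)))%R.
Proof.
split; [apply/eqP; rewrite eq_le turan_density_family2_le /=|rewrite lt_min; apply/andP; split].
- have := @turan_density_blow_up R (family2 F32 C5minus) 3 _ edge_pattern_ts isT.
  have -> : count_triples 3 edge_pattern = 6 by vm_compute.
  rewrite (_ : 6 / 3 ^+ 3 = 2 / 9); last by lra.
  apply=> m F [->|->]; first exact/blow_up_F32_free/edge_pattern_F32_free.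
  exact/blow_up_C5minus_free/edge_pattern_C5minus_free.
- have := @turan_density_blow_up R (family1 F32) 4 _ K4minus_pattern_ts isT.
  have -> : count_triples 4 K4minus_pattern = 18 by vm_compute.
  move=> lb; apply: lt_le_trans (lb _); first by lra.
  by move=> m F ->; apply/blow_up_F32_free/K4minus_pattern_F32_free.
- have := @turan_density_blow_up R (family1 C5minus) 9 _ F32_weighted_ts isT.
  have -> : count_triples 9 F32_weighted = 168 by vm_compute.
  move=> lb; apply: lt_le_trans (lb _); first by lra.
  by move=> m F ->; apply/blow_up_C5minus_free/F32_weighted_C5minus_free.
Qed.
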